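(* Let $\mathfrak{U}$ be a Banach algebra such that $\mathfrak{U}^\sharp$ is symmetrically pseudo-amenable, with a symmetric approximate diagonal $\{\mathbf{t}_\lambda\}_{\lambda\in\Lambda}\subseteq\mathfrak{U}^\sharp\widehat{\otimes}\mathfrak{U}^\sharp$. Let $X$ be a Banach $\mathfrak{U}$-bimodule such that (i) for each $x\in X$ the net $\{\psi_x(\mathbf{t}_\lambda)\}_{\lambda\in\Lambda}$ is bounded, and (ii) for each bounded Jordan derivation $D:\mathfrak{U}\to X$ the net $\{\Phi_D(\mathbf{t}_\lambda)\}_{\lambda\in\Lambda}$ is bounded. Then every bounded Jordan derivation from $\mathfrak{U}$ into $X$ is a derivation.
   Context: $\mathfrak{U}^\sharp=\mathfrak{U}\oplus\mathbb{C}1$ is the unitization of $\mathfrak{U}$ with the $\ell^1$-norm (a unit is adjoined even if $\mathfrak{U}$ is unital); a Banach $\mathfrak{U}$-bimodule $X$ is made a unital Banach $\mathfrak{U}^\sharp$-bimodule by $1x=x1=x$. For $x\in X$, $\psi_x:\mathfrak{U}^\sharp\widehat{\otimes}\mathfrak{U}^\sharp\to X$ is the bounded linear map with $\psi_x(a\otimes b)=axb$. For a bounded linear map $T:\mathfrak{U}\to X$, extended to $\mathfrak{U}^\sharp$ by $T(1)=0$, $\Phi_T:\mathfrak{U}^\sharp\widehat{\otimes}\mathfrak{U}^\sharp\to X$ is the bounded linear map with $\Phi_T(a\otimes b)=aT(b)$. A linear map $\delta:\mathfrak{U}\to X$ is a derivation if $\delta(ab)=\delta(a)b+a\delta(b)$,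 and a Jordan derivation if $\delta(ab+ba)=\delta(a)b+a\delta(b)+\delta(b)a+b\delta(a)$, for all $a,b$. For a Banach algebra $\mathfrak{A}$, $\mathfrak{A}\widehat{\otimes}\mathfrak{A}$ is the projective tensor product with $a(b\otimes c)=ab\otimes c$, $(b\otimes c)a=b\otimes ca$, $\pi(b\otimes c)=bc$ (extended linearly and continuously); the flip is $(b\otimes c)^\circ=c\otimes b$ and $\mathbf{t}$ is symmetric if $\mathbf{t}^\circ=\mathbf{t}$. A symmetric approximate diagonal is a net $\{\mathbf{t}_\lambda\}$ (not necessarily bounded) of symmetric elements with $a\mathbf{t}_\lambda-\mathbf{t}_\lambda a\to0$ and $\pi(\mathbf{t}_\lambda)a\to a$ for all $a\in\mathfrak{A}$; $\mathfrak{A}$ is symmetrically pseudo-amenable if it has one. *)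

(* Defs.v *)
From HB Require Import structures.
From mathcomp Require Import all_boot all_order all_algebra.
From mathcomp Require Import all_classical all_reals all_analysis.
From mathcomp Require Export complex.
Export Order.TTheory GRing.Theory Num.Theory.
Export numFieldNormedType.Exports.

Set Implicit Arguments.
Unset Strict Implicit.
Unset Printing Implicit Defensive.

Local Open Scope classical_set_scope.
Local Open Scope ring_scope.

HB.instance Definition _ (R : realType) := NormedModule.copy R[i] (R[i])^o.

Section BanachDefs.
Variable R : realType.
Local Notation C := (R[i]).

Variable U : completeNormedModType C.
Variable mul : U -> U -> U.

Definition banach_algebra : Prop :=
  [/\ (forall a b c, mul (mul a b) c = mul a (mul b c)),
      (forall (k : C) a a' b, mul (k *: a + a') b = k *: mul a b + mul a' b),
      (forall (k : C) a b b', mul a (k *: b + b') = k *: mul a b + mul a b') &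
      (forall a b, `|mul a b| <= `|a| * `|b|)].

(* Unitization U^# = U (+) C1 with the l^1 norm; (a, al) stands for a + al 1 *)
Definition ush := (U * C)%type.
Definition ush_mul (p q : ush) : ush :=
  (mul p.1 q.1 + p.2 *: q.1 + q.2 *: p.1, p.2 * q.2).
Definition ush_norm (p : ush) : C := `|p.1| + `|p.2|.

Variable X : completeNormedModType C.
Variable lact : U -> X -> X.
Variable ract : X -> U -> X.

Definition banach_bimodule : Prop :=
  (forall (k : C) a a' x, lact (k *: a + a') x = k *: lact a x + lact a' x) /\
  (forall (k : C) a x x', lact a (k *: x + x') = k *: lact a x + lact a x') /\
  (forall (k : C) x x' a, ract (k *: x + x') a = k *: ract x a + ract x' a) /\
  (forall (k : C) x a a', ract x (k *: a + a') = k *: ract x a + ract x a') /\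
  (forall a b x, lact (mul a b) x = lact a (lact b x)) /\
  (forall a b x, ract x (mul a b) = ract (ract x a) b) /\
  (forall a b x, ract (lact a x) b = lact a (ract x b)) /\
  (forall a x, `|lact a x| <= `|a| * `|x|) /\
  (forall a x, `|ract x a| <= `|x| * `|a|).

Definition ush_lact (p : ush) (x : X) : X := lact p.1 x + p.2 *: x.
Definition ush_ract (x : X) (p : ush) : X := ract x p.1 + p.2 *: x.

(* The projective tensor product U^# (^x) U^#.  An element is represented *)
(* by a sequence (u_n, v_n) with sum_n ||u_n|| ||v_n|| < oo, standing for  *)
(* sum_n u_n (x) v_n.  Two representations denote the same element iff    *)
(* every bounded bilinear form takes the same value on them (duality       *)
(* (U^# (^x) U^#)^* = bounded bilinear forms); the projective norm is the  *)
(* infimum of sum_n ||u_n|| ||v_n|| over all representations.             *)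
Definition tensor_rep := nat -> (ush * ush)%type.

Definition tr_summable (t : tensor_rep) : Prop :=
  exists M : C, forall N : nat,
    \sum_(n < N) ush_norm (t n).1 * ush_norm (t n).2 <= M.

Definition bounded_bilinear_form (B : ush -> ush -> C) : Prop :=
  [/\ (forall (k : C) u u' v, B (k *: u + u') v = k * B u v + B u' v),
      (forall (k : C) u v v', B u (k *: v + v') = k * B u v + B u v') &
      exists K : C, forall u v, `|B u v| <= K * ush_norm u * ush_norm v].

Definition tr_equiv (t s : tensor_rep) : Prop :=
  forall B, bounded_bilinear_form B ->
    (fun N : nat => \sum_(n < N) (B (t n).1 (t n).2 - B (s n).1 (s n).2))
      @ \oo --> (0 : C).

Definition proj_norm_le (t : tensor_rep) (e : C) : Prop :=
  forall d : C, 0 < d -> exists s : tensor_rep, tr_equiv t s /\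
    forall N : nat, \sum_(n < N) ush_norm (s n).1 * ush_norm (s n).2 <= e + d.

Definition tr_sub (t s : tensor_rep) : tensor_rep :=
  fun n => if odd n then (- (s n./2).1, (s n./2).2) else t n./2.
Definition tr_lmul (a : ush) (t : tensor_rep) : tensor_rep :=
  fun n => (ush_mul a (t n).1, (t n).2).
Definition tr_rmul (t : tensor_rep) (a : ush) : tensor_rep :=
  fun n => ((t n).1, ush_mul (t n).2 a).
Definition tr_flip (t : tensor_rep) : tensor_rep :=
  fun n => ((t n).2, (t n).1).
Definition tr_pi (t : tensor_rep) : ush :=
  (limn (fun N : nat => \sum_(n < N) (ush_mul (t n).1 (t n).2).1),
   limn (fun N : nat => \sum_(n < N) (ush_mul (t n).1 (t n).2).2)).
Definition tr_psi (x : X) (t : tensor_rep) : X :=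
  limn (fun N : nat => \sum_(n < N) ush_lact (t n).1 (ush_ract x (t n).2)).
(* Phi_T (a (x) b) = a T(b), with T extended to U^# by T(1) = 0 *)
Definition tr_Phi (T : U -> X) (t : tensor_rep) : X :=
  limn (fun N : nat => \sum_(n < N) ush_lact (t n).1 (T (t n).2.1)).

Definition directed (L : Type) (le : L -> L -> Prop) : Prop :=
  [/\ (forall l, le l l),
      (forall l1 l2 l3, le l1 l2 -> le l2 l3 -> le l1 l3),
      (forall l1 l2, exists l3, le l1 l3 /\ le l2 l3) &
      inhabited L].

Definition eventually_net (L : Type) (le : L -> L -> Prop) (P : L -> Prop) :=
  exists l0, forall l, le l0 l -> P l.

Definition symmetric_approx_diagonal (L : Type) (le : L -> L -> Prop)
    (t : L -> tensor_rep) : Prop :=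
  [/\ (forall l, tr_summable (t l)),
      (forall l, tr_equiv (tr_flip (t l)) (t l)),
      (forall (a : ush) (e : C), 0 < e -> eventually_net le
          (fun l => proj_norm_le (tr_sub (tr_lmul a (t l)) (tr_rmul (t l) a)) e)) &
      (forall (a : ush) (e : C), 0 < e -> eventually_net le
          (fun l => ush_norm (ush_mul (tr_pi (t l)) a - a) <= e))].

Definition linear_map (T : U -> X) : Prop :=
  forall (k : C) a b, T (k *: a + b) = k *: T a + T b.

Definition bounded_map (T : U -> X) : Prop :=
  exists K : C, forall a, `|T a| <= K * `|a|.

Definition derivation (T : U -> X) : Prop :=
  linear_map T /\ forall a b, T (mul a b) = ract (T a) b + lact a (T b).

Definition jordan_derivation (T : U -> X) : Prop :=
  linear_map T /\ forall a b,
    T (mul a b + mul b a) = ract (T a) b + lact a (T b) + ract (T b) a + lact b (T a).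

End BanachDefs.

(* Main.v *)
Require Import Defs.
From HB Require Import structures.
From mathcomp Require Import all_boot all_order all_algebra.
From mathcomp Require Import all_classical all_reals all_analysis.
From mathcomp Require Import complex.
From mathcomp Require Import ring lra.

(* Let [t = sum u_i (x) v_i] be a symmetric tensor with [a t - t a] small. For
   a Jordan derivation [T], evaluating both [u (x) v |-> u T(v)] and
   [u (x) v |-> v T(u)] on [a t - t a] and subtracting gives
     a Phi_T(t) - Phi_T(t) a ~ pi(t) T(a) + psi_{T(a)}(t).          (1)
   Since [psi_y(t)] is almost central, the maps
   [E_l(a) = a Phi_D(t_l) - Phi_D(t_l) a - D(a)] are uniformly bounded Jordan
   derivations with [c E_l(a) - E_l(a) c -> 0]; the Jordan identity then gives
   [[c, a] E_l(b) + [c, b] E_l(a) -> 0].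
   Now fix one [t = t_m] and apply (1) to [T = E_l]. As [l] grows, by dominated
   convergence the left-hand side approaches [sum_i [u_i, v_i] E_l(a)], which
   vanishes by symmetry, while the right-hand side approaches
   [2 pi(t) E_l(a) ~ 2 E_l(a)]. Hence [E_l(a) -> 0], so [D] is a pointwise limit
   of inner derivations. Working with the net [E_l] in [X] replaces the usual
   weak-* limits in the bidual.
   The tensors are only known up to scalar bounded bilinear forms, and the
   Hahn-Banach theorem transfers identities to [X]-valued ones. *)

Set Implicit Arguments.
Unset Strict Implicit.
Unset Printing Implicit Defensive.

Local Open Scope classical_set_scope.
Local Open Scope ring_scope.
Local Open Scope complex_scope.

(** * Separation by bounded functionals *)

Section HahnBanach.
Context {R : realType} {V : lmodType R[i]}.
Implicit Types (p q : V -> R) (x y : V) (s t : R).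

(** Only the real structure of the complex module [V] matters here, hence scalars of the form [t%:C]
    with [t] real. *)
Definition sublinear p :=
  (forall x y, p (x + y) <= p x + p y) /\
  (forall t x, 0 <= t -> p (t%:C *: x) = t * p x).

Lemma sublinear0 p : sublinear p -> p 0 = 0.
Proof. by case=> _ /(_ 0 0 (lexx _)); rewrite scaler0 mul0r. Qed.

Lemma sublinear_ge p x : sublinear p -> - p (- x) <= p x.
Proof.
move=> sp; have [/(_ x (- x)) + _] := sp.
by rewrite subrr (sublinear0 sp); lra.
Qed.

Definition shift_set p y x :=
  [set p (x + t%:C *: y) - t * p y | t in [set t | 0 <= t]].

(* A sublinear functional below [p] at which adding [y] costs at most [p y]:
   if [p] is minimal then it equals its shift, which makes it additive. *)
Definition shift p y x := inf (shift_set p y x).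

Lemma shift_le p y x t : sublinear p -> 0 <= t ->
  shift p y x <= p (x + t%:C *: y) - t * p y.
Proof.
move=> sp t0; apply: ge_inf; last by exists t.
(* The set is bounded below by [- p (- x)], since [u * p y = p (u y)] is at most
   [p (x + u y) + p (- x)]. *)
exists (- p (- x)) => _ [u /= u0 <-]; have [pD pZ] := sp.
by have := pD (x + u%:C *: y) (- x); rewrite addrAC subrr add0r pZ//; lra.
Qed.

Lemma shift_ge p y x c :
  (forall t, 0 <= t -> c <= p (x + t%:C *: y) - t * p y) -> c <= shift p y x.
Proof.
move=> h; apply: lb_le_inf; first by exists (p (x + 0%:C *: y) - 0 * p y); exists 0 => /=.
by move=> _ [t /= t0 <-]; exact: h.
Qed.

Lemma shift_le_self p y x : sublinear p -> shift p y x <= p x.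
Proof.
by move=> sp; have := @shift_le p y x 0 sp (lexx _); rewrite rmorph0 scale0r addr0 mul0r subr0.
Qed.

(** For subadditivity, parameters [t] and [t'] for the summands give the parameter [t + t'] for the
    sum. For homogeneity, one inequality at [s > 0] suffices, as the other is its instance at
    [s^-1]. *)
Lemma sublinear_shift p y : sublinear p -> sublinear (shift p y).
Proof.
move=> sp; have [pD pZ] := sp.
have homle s x : 0 < s -> shift p y (s%:C *: x) <= s * shift p y x.
  move=> s0; rewrite mulrC -ler_pdivrMr//; apply: shift_ge => t t0.
  rewrite ler_pdivrMr//.
  have := @shift_le p y (s%:C *: x) (s * t) sp (mulr_ge0 (ltW s0) t0).
  by rewrite rmorphM -scalerA -scalerDr pZ ?(ltW s0)//; lra.
split=> [x x'|s x].
  rewrite -lerBlDr; apply: shift_ge => t t0.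
  rewrite lerBlDr -lerBlDl; apply: shift_ge => t' t'0; rewrite lerBlDl.
  have := @shift_le p y (x + x') (t + t') sp (addr_ge0 t0 t'0).
  rewrite rmorphD scalerDl addrACA => /le_trans; apply.
  by have := pD (x + t%:C *: y) (x' + t'%:C *: y); lra.
rewrite le_eqVlt => /orP[/eqP<-|s0].
  rewrite rmorph0 scale0r mul0r; apply/eqP; rewrite eq_le; apply/andP; split.
    by rewrite -[leRHS](sublinear0 sp) shift_le_self.
  by apply: shift_ge => t t0; rewrite add0r pZ// subrr.
apply/eqP; rewrite eq_le homle//=.
have := @homle s^-1 (s%:C *: x); rewrite invr_gt0 => /(_ s0).
rewrite scalerA -rmorphM mulVf ?gt_eqF// scale1r.
by rewrite -(ler_pM2l s0) mulrA mulfV ?gt_eqF// mul1r.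
Qed.

(** Zorn's lemma for the reversed pointwise order. A nonempty chain is bounded by its pointwise
    infimum, which is finite because [- q (- x)] lies below every member; it is subadditive because
    the smaller of two members serves both points. The empty chain is bounded by [q]. *)
Lemma minimal_sublinear q : sublinear q -> exists p, [/\ sublinear p,
  (forall x, p x <= q x) &
  forall p', sublinear p' -> (forall x, p' x <= p x) -> p' = p].
Proof.
move=> sq; pose T := {p | sublinear p /\ forall x, p x <= q x}.
have mk p (sp : sublinear p) (pq : forall x, p x <= q x) : {a : T | sval a = p}.
  by exists (exist (fun p => sublinear p /\ forall x, p x <= q x) p (conj sp pq)).
pose r (a b : T) := `[< forall x, sval b x <= sval a x >].
have [| | |A totA|a amin] := @Zorn T r.
- by move=> a; apply/asboolP.
- move=> a b c /asboolP ab /asboolP bc; apply/asboolP => x.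
  exact: le_trans (bc x) (ab x).
- move=> [a sa] [b sb] /asboolP ab /asboolP ba; apply: eq_exist => /=.
  by apply/funext => x; apply/eqP; rewrite eq_le ab ba.
- have [[a0 Aa0]|/nonemptyPn A0] := pselect (A !=set0); last first.
    by have [b _] := mk q sq (fun x => lexx _); exists b => s; rewrite A0.
  pose E x := [set sval a x | a in A].
  have lbE x (a : T) : A a -> inf (E x) <= sval a x.
    move=> Aa; apply: ge_inf; last by exists a.
    exists (- q (- x)) => _ [b Ab <-]; case: b Ab => b [sb bq] _ /=.
    by apply: le_trans (sublinear_ge x sb); rewrite lerN2.
  have geE x c : (forall a : T, A a -> c <= sval a x) -> c <= inf (E x).
    move=> h; apply: lb_le_inf; first by exists (sval a0 x); exists a0.
    by move=> _ [a Aa <-]; exact: h.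
  suff sE : sublinear (fun x => inf (E x)).
    have Eq x : inf (E x) <= q x.
      by apply: le_trans (lbE x a0 Aa0) _; case: (a0) => a [].
    have [b bE] := mk _ sE Eq; exists b => s As; apply/asboolP => x.
    by rewrite bE; exact: lbE.
  split=> [x y|t x] /=.
    rewrite -lerBlDr; apply/geE => a Aa.
    rewrite lerBlDr -lerBlDl; apply/geE => b Ab; rewrite lerBlDl.
    have [/asboolP ab|/asboolP ba] := totA a b Aa Ab.
      apply: le_trans (lbE (x + y) b Ab) _.
      by have [[/(_ x y) + _] _] := svalP b; have := ab x; lra.
    apply: le_trans (lbE (x + y) a Aa) _.
    by have [[/(_ x y) + _] _] := svalP a; have := ba y; lra.
  rewrite le_eqVlt => /orP[/eqP<-|t0].
    rewrite rmorph0 scale0r mul0r; apply/eqP; rewrite eq_le; apply/andP; split.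
      by apply: le_trans (lbE 0 a0 Aa0) _; rewrite sublinear0//; case: (svalP a0).
    by apply/geE => a Aa; rewrite sublinear0//; case: (svalP a).
  apply/eqP; rewrite eq_le; apply/andP; split.
    rewrite mulrC -ler_pdivrMr//; apply/geE => a Aa; rewrite ler_pdivrMr//.
    apply: le_trans (lbE _ _ Aa) _.
    by have [[_ aZ] _] := svalP a; rewrite aZ ?(ltW t0)// mulrC.
  apply/geE => a Aa; have [[_ aZ] _] := svalP a; rewrite aZ ?(ltW t0)//.
  by rewrite ler_pM2l// lbE.
- have [sa aq] := svalP a; exists (sval a); split=> // p sp pa.
  have [b bE] := mk p sp (fun x => le_trans (pa x) (aq x)).
  by rewrite -bE (amin b)//; apply/asboolP => x; rewrite bE.
Qed.

(** The Hahn-Banach theorem in sublinear form: a minimal [p] equals each of its shifts, and the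
    parameter 1 then yields [p x <= p (x + y) - p y], the missing half of additivity. *)
Lemma linear_below_sublinear q : sublinear q -> exists g : V -> R,
  [/\ (forall x y, g (x + y) = g x + g y),
      (forall t x, g (t%:C *: x) = t * g x) & (forall x, g x <= q x)].
Proof.
move=> sq; have [p [sp pq pmin]] := minimal_sublinear sq.
have [pD pZ] := sp.
have padd x y : p (x + y) = p x + p y.
  apply/eqP; rewrite eq_le pD/=.
  have e := pmin _ (sublinear_shift y sp) (fun z => shift_le_self y z sp).
  have := @shift_le p y x 1 sp ler01.
  by rewrite e rmorph1 scale1r; lra.
have popp x : p (- x) = - p x.
  by apply/eqP; rewrite -subr_eq0 opprK -padd addNr (sublinear0 sp).
exists p; split=> // t x; have [|t0] := lerP 0 t; first exact: pZ.
rewrite -[t in LHS]opprK rmorphN scaleNr popp pZ; last by rewrite oppr_ge0 ltW.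
by rewrite mulNr opprK.
Qed.

End HahnBanach.

Lemma normc_le_ReIm (R : realType) (z : R[i]) :
  `|z| <= (`|Re z| + `|Im z|)%:C.
Proof.
rewrite normc_def lecR -[leRHS]ger0_norm ?addr_ge0// -sqrtr_sqr.
rewrite ler_sqrt ?sqr_ge0// sqrrD !real_normK ?num_real// lerD2r lerDl.
by rewrite mulrn_wge0// mulr_ge0.
Qed.

(* A complex functional is recovered from its real part [g] as
   [x |-> g x - 'i * g ('i *: x)]; the constant 2 below is not optimal. *)
Lemma separating_functional (R : realType) (X : normedModType R[i]) (x0 : X) :
  x0 != 0 ->
  exists2 f : {scalar X}, f x0 != 0 & forall x, `|f x| <= 2 * `|x|.
Proof.
move=> x0N0; pose nrm (x : X) : R := Re `|x|.
have nrmE x : (nrm x)%:C = `|x| by rewrite RRe_real// normr_real.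
have snrm : sublinear nrm.
  split=> [x y|t x t0].
    by rewrite -lecR rmorphD /= !nrmE ler_normD.
  apply: complexI; rewrite rmorphM /= !nrmE normrZ; congr (_ * _).
  by rewrite ger0_norm// ler0c.
(* Dominating [g] by the shift of the norm along [x0], not by the norm itself, forces
   [g (- x0) <= - nrm x0 < 0], so that [g] does not vanish at [x0]. *)
have [g [gD gZ gle]] := linear_below_sublinear (sublinear_shift x0 snrm).
have gN x : g (- x) = - g x by have := gZ (-1) x; rewrite rmorphN1 scaleN1r mulN1r.
have g_nrm x : `|g x| <= nrm x.
  rewrite ler_norml lerNl -gN !(le_trans (gle _)) ?shift_le_self//.
  by apply: le_trans (shift_le_self _ _ snrm) _; rewrite /nrm normrN.
have gx0 : g x0 != 0.
  rewrite gt_eqF// -oppr_lt0 -gN; apply: le_lt_trans (gle _) _.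
  have := @shift_le _ _ nrm x0 (- x0) 1 snrm ler01.
  rewrite rmorph1 scale1r addNr mul1r (sublinear0 snrm) => /le_lt_trans; apply.
  by rewrite sub0r oppr_lt0 -ltcR nrmE normr_gt0.
pose f (x : X) : R[i] := g x +i* (- g ('i%C *: x)).
have g_complex (k : R[i]) x : g (k *: x) = Re k * g x + Im k * g ('i%C *: x).
  by rewrite {1}[k]complexE scalerDl gD gZ ['i%C * _]mulrC -scalerA gZ.
have f_scalar : scalar f.
  move=> k x y; apply/eqP; rewrite /f eq_complex/= scalerDr !gD scalerA.
  rewrite (g_complex k) (g_complex ('i%C * k)); case: k => a b /=.
  by apply/andP; split; apply/eqP; ring.
pose F : {scalar X} := HB.pack f (GRing.isLinear.Build _ _ _ _ _ f_scalar).
exists F => [|x].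
  by rewrite /F /= /f eq_complex negb_and /= gx0.
apply: le_trans (normc_le_ReIm _) _.
rewrite -nrmE -(rmorph_nat (real_complex R)) -rmorphM lecR /= normrN.
have nrm_i : nrm ('i%C *: x) = nrm x.
  by apply: complexI; rewrite !nrmE normrZ normc_def /= expr0n expr1n add0r sqrtr1 mul1r.
by rewrite mulrDl mul1r lerD// -[leRHS]nrm_i.
Qed.

(** * Sums of bilinear maps over a tensor *)

Lemma eq_by_functionals (R : realType) (X : normedModType R[i]) (x y : X) :
  (forall f : {scalar X}, f x = f y) -> x = y.
Proof.
move=> fxy; apply/eqP; rewrite -subr_eq0; apply/negPn/negP.
move=> /separating_functional[f /negP + _]; apply.
by rewrite linearB subr_eq0 fxy.
Qed.

Section TensorSum.
Context (R : realType) (U X : completeNormedModType R[i]).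
Local Notation C := R[i].
Implicit Types (B : ush U -> ush U -> X) (t s : tensor_rep U) (K M e : C).

Lemma ush_norm_ge0 (p : ush U) : 0 <= ush_norm p.
Proof. by rewrite addr_ge0. Qed.

Definition mass t n : C := ush_norm (t n).1 * ush_norm (t n).2.

Lemma mass_ge0 t n : 0 <= mass t n.
Proof. by rewrite mulr_ge0 ?ush_norm_ge0. Qed.

(** [R[i]] is only partially ordered, so the partial sums are replaced by their real parts, where a
    supremum exists; [N] is an index that reaches it up to [e]. *)
Lemma tr_summable_tail t e : tr_summable t -> 0 < e ->
  exists N, forall m, (N <= m)%N -> \sum_(N <= n < m) mass t n <= e.
Proof.
case=> M tM e0; pose r N := Re (\sum_(n < N) mass t n).
have rE N : (r N)%:C = \sum_(n < N) mass t n.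
  by rewrite RRe_real// ger0_real// sumr_ge0// => n _; exact: mass_ge0.
have eE : (Re e)%:C = e by rewrite RRe_real// gtr0_real.
have re0 : 0 < Re e by rewrite -ltcR eE.
have rM N : r N <= Re M.
  have := tM N; rewrite -rE lecE => /andP[_]; exact.
have supr : has_sup (range r).
  by split; [exists (r 0), 0 | exists (Re M) => _ [n _ <-]].
have [_ [N _ <-] rN] := sup_adherent re0 supr.
exists N => m Nm; rewrite -eE.
have -> : \sum_(N <= n < m) mass t n = (r m - r N)%:C.
  rewrite rmorphB /= !rE -!(big_mkord xpredT (mass t)).
  by rewrite (big_cat_nat (leq0n N) Nm) /= addrC addrK.
by rewrite lecR; have : r m <= sup (range r) by [apply: sup_upper_bound => //; exists m]; lra.
Qed.

(** Domination makes the sums over a tensor converge; bilinearity is added in [bounded_bilinear],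
    for passing to another representation. *)
Definition dominated B K := forall u v, `|B u v| <= K * ush_norm u * ush_norm v.

Lemma dominated_ge0 B K : dominated B K -> 0 <= K.
Proof.
move/(_ (0, 1) (0, 1)) => /(le_trans (normr_ge0 _)).
by rewrite /ush_norm /= normr0 normr1 add0r !mulr1.
Qed.

Definition tpart B t N : X := \sum_(n < N) B (t n).1 (t n).2.
(** The value at [t] of the linear map on the projective tensor product induced by [B]; [tr_psi] and
    [tr_Phi] are instances by unfolding. *)
Definition tsum B t : X := limn (tpart B t).

Lemma norm_tpart B K t N : dominated B K ->
  `|tpart B t N| <= K * \sum_(n < N) mass t n.
Proof.
move=> BK; rewrite mulr_sumr; apply: le_trans (ler_norm_sum _ _ _) _.
by apply: ler_sum => n _; rewrite mulrA.
Qed.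

Lemma norm_tpartB B K t N m : dominated B K -> (N <= m)%N ->
  `|tpart B t m - tpart B t N| <= K * \sum_(N <= n < m) mass t n.
Proof.
move=> BK Nm.
have E k : tpart B t k = \sum_(0 <= n < k) B (t n).1 (t n).2 by rewrite big_mkord.
rewrite !E (big_cat_nat (leq0n N) Nm) /= addrC addrK mulr_sumr.
apply: le_trans (ler_norm_sum _ _ _) _.
by apply: ler_sum => n _; rewrite mulrA.
Qed.

(** [N] is chosen before [B] and [K], since the masses of [t] alone control the tail. This
    uniformity is what dominated convergence in [tsum_null] rests on. *)
Lemma tpart_tail t e : tr_summable t -> 0 < e ->
  exists N, forall B K m, dominated B K -> (N <= m)%N ->
    `|tpart B t m - tpart B t N| <= K * e.
Proof.
move=> ts e0; have [N Ne] := tr_summable_tail ts e0.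
exists N => B K m BK Nm; apply: le_trans (norm_tpartB t BK Nm) _.
by rewrite ler_wpM2l ?(dominated_ge0 BK)// Ne.
Qed.

Lemma tsum_cvg B K t : tr_summable t -> dominated B K ->
  tpart B t @ \oo --> tsum B t.
Proof.
move=> ts BK; apply/cauchy_cvgP/cauchy_exP => e e0.
have K0 := dominated_ge0 BK.
have K1 : 0 < K + 1 by rewrite ltr_wpDl.
(* Dividing by [K + 1] allows [K = 0] and leaves the strict inequality needed for the ball. *)
have [N Ne] := tpart_tail ts (divr_gt0 e0 K1).
exists (tpart B t N); exists N => // m /= Nm.
rewrite -ball_normE /ball_ /= distrC; apply: le_lt_trans (Ne _ _ m BK Nm) _.
by rewrite mulrA ltr_pdivrMr// mulrC ltr_pM2l// ltrDl.
Qed.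

Lemma tsum_tail t e : tr_summable t -> 0 < e ->
  exists N, forall B K, dominated B K -> `|tsum B t - tpart B t N| <= K * e.
Proof.
move=> ts e0; have [N Ne] := tpart_tail ts e0.
exists N => B K BK; apply/ler_addgt0Pr => d d0.
have /cvgrPdist_le /(_ d d0)[m _ mP] := tsum_cvg ts BK.
rewrite -(subrK (tpart B t (maxn N m)) (tsum B t)) -addrA addrC.
apply: le_trans (ler_normD _ _) _; apply: lerD.
  by apply: Ne => //; exact: leq_maxl.
by apply: mP; exact: leq_maxr.
Qed.

Lemma norm_tsum_le B K M t : dominated B K ->
  (forall N, \sum_(n < N) mass t n <= M) -> `|tsum B t| <= K * M.
Proof.
move=> BK tM; have ts : tr_summable t by exists M.
apply/ler_addgt0Pr => d d0.
have /cvgrPdist_le /(_ d d0)[m _ mP] := tsum_cvg ts BK.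
rewrite -(subrK (tpart B t m) (tsum B t)) addrC.
apply: le_trans (ler_normD _ _) _; apply: lerD; last by apply: mP => /=.
apply: le_trans (norm_tpart t m BK) _.
by rewrite ler_wpM2l// (dominated_ge0 BK).
Qed.

Lemma tsum_eq B t (x : X) : tpart B t @ \oo --> x -> tsum B t = x.
Proof. by move=> /cvg_lim; apply; exact: norm_hausdorff. Qed.

Lemma tsumD B B' K K' t : tr_summable t -> dominated B K -> dominated B' K' ->
  tsum (fun u v => B u v + B' u v) t = tsum B t + tsum B' t.
Proof.
move=> ts BK BK'; apply: tsum_eq.
rewrite (_ : tpart _ t = tpart B t \+ tpart B' t).
  exact: cvgD (tsum_cvg ts BK) (tsum_cvg ts BK').
by apply/funext => N; rewrite /tpart/= big_split.
Qed.

Lemma tsumB B B' K K' t : tr_summable t -> dominated B K -> dominated B' K' ->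
  tsum (fun u v => B u v - B' u v) t = tsum B t - tsum B' t.
Proof.
move=> ts BK BK'; apply: tsum_eq.
rewrite (_ : tpart _ t = tpart B t \- tpart B' t).
  exact: cvgB (tsum_cvg ts BK) (tsum_cvg ts BK').
by apply/funext => N; rewrite /tpart/= sumrB.
Qed.

End TensorSum.

Lemma bounded_linear_cvg (R : realType) (X Y : normedModType R[i])
    (g : X -> Y) (c : R[i]) (u : nat -> X) (x : X) :
  linear g -> 0 <= c -> (forall x, `|g x| <= c * `|x|) ->
  u @ \oo --> x -> (fun n => g (u n)) @ \oo --> g x.
Proof.
move=> gl c0 gc ux; apply/cvgrPdist_le => e e0.
have c1 : 0 < c + 1 by rewrite ltr_wpDl.
move/cvgrPdist_le: ux => /(_ _ (divr_gt0 e0 c1)).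
pose G : {linear X -> Y} := HB.pack g (GRing.isLinear.Build _ _ _ _ g gl).
apply: filterS => N; rewrite ler_pdivlMr// (_ : g x - g (u N) = G (x - u N)).
  by apply: le_trans; apply: le_trans (gc _) _; rewrite mulrC ler_wpM2l// lerDl.
by rewrite raddfB.
Qed.

(** * Independence of the representation and the projective norm *)

Section TensorSumTheory.
Context (R : realType) (U X : completeNormedModType R[i]).
Local Notation C := R[i].
Implicit Types (B : ush U -> ush U -> X) (t s : tensor_rep U) (K M e : C).

Lemma tsum_linear g c B K t : linear g -> 0 <= c ->
  (forall x : X, `|g x : X| <= c * `|x|) -> tr_summable t -> dominated B K ->
  tsum (fun u v => g (B u v)) t = g (tsum B t).
Proof.
move=> gl c0 gc ts BK; apply: tsum_eq.
rewrite (_ : tpart _ t = fun N => g (tpart B t N)).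
  exact: bounded_linear_cvg gl c0 gc (tsum_cvg ts BK).
apply/funext => N; rewrite /tpart.
pose G : {linear X -> X} := HB.pack g (GRing.isLinear.Build _ _ _ _ g gl).
exact: esym (raddf_sum G _ _ _).
Qed.

Definition bounded_bilinear B K : Prop :=
  [/\ (forall (k : C) u u' v, B (k *: u + u') v = k *: B u v + B u' v),
      (forall (k : C) u v v', B u (k *: v + v') = k *: B u v + B u v') &
      dominated B K].

(** Composing [B] with a functional [f] gives a scalar form, to which [tr_equiv] applies. If the two
    sums differed, some bounded [f] would be nonzero on their difference. *)
Lemma tsum_equiv B K t s : tr_summable t -> tr_summable s -> tr_equiv t s ->
  bounded_bilinear B K -> tsum B t = tsum B s.
Proof.
move=> ts ss ets [Bl Br BK]; apply/eqP; rewrite -subr_eq0.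
apply/negPn/negP => /separating_functional[f /eqP fN0 f2]; apply: fN0.
have fB : bounded_bilinear_form (fun u v => f (B u v)).
  split=> [k u u' v|k u v v'|]; rewrite ?Bl ?Br ?linearP//.
  exists (2 * K) => u v; apply: le_trans (f2 _) _.
  by rewrite -!mulrA ler_wpM2l// mulrA BK.
have cvgX : (fun N => tpart B t N - tpart B s N) @ \oo --> tsum B t - tsum B s.
  exact: cvgB (tsum_cvg ts BK) (tsum_cvg ss BK).
apply/eqP; rewrite -normr_le0; apply/ler_addgt0Pr => e e0; rewrite add0r.
(* [f] may double norms, so an error [e / 4] in [X] costs [e / 2] in the scalars. *)
have e4 : 0 < e / 4 by rewrite divr_gt0.
have e2 : 0 < e / 2 by rewrite divr_gt0.
have /cvgr0Pnorm_le /(_ _ e2)[m _ mP] := ets _ fB.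
have /cvgrPdist_le /(_ _ e4)[m' _ mP'] := cvgX.
have := mP (maxn m m') (leq_maxl _ _); have := mP' (maxn m m') (leq_maxr _ _).
set N := maxn m m' => /= leX leC.
rewrite -(subrK (f (tpart B t N - tpart B s N)) (f _)).
apply: le_trans (ler_normD _ _) _; have -> : e = e / 2 + e / 2 by field.
rewrite lerD//.
  rewrite -linearB; apply: le_trans (f2 _) _.
  apply: le_trans (ler_wpM2l (ler0n _ 2) leX) _.
  by rewrite le_eqVlt; apply/orP; left; apply/eqP; field.
by move: leC; rewrite sumrB linearB /tpart !linear_sum.
Qed.

Lemma sum_double (V : zmodType) (F : nat -> V) N :
  \sum_(n < N.*2) F n = \sum_(n < N) (F n.*2 + F n.*2.+1).
Proof.
elim: N => [|N IH]; first by rewrite !big_ord0.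
by rewrite doubleS !big_ord_recr /= IH addrA.
Qed.

Lemma tr_summable_sub t s :
  tr_summable t -> tr_summable s -> tr_summable (tr_sub t s).
Proof.
move=> [M tM] [M' sM]; exists (M + M') => N.
(* Passing to the even length only adds nonnegative terms and gives [N] terms of each of [t] and
   [s]. *)
apply: (@le_trans _ _ (\sum_(n < N.*2) mass (tr_sub t s) n)).
  rewrite -!(big_mkord xpredT (mass (tr_sub t s))).
  have NN : (N <= N.*2)%N by rewrite -addnn leq_addl.
  rewrite (big_cat_nat (leq0n N) NN) /= lerDl sumr_ge0// => n _.
  exact: mass_ge0.
rewrite sum_double big_split lerD//=.
  apply: le_trans (tM N); rewrite le_eqVlt; apply/orP; left; apply/eqP.
  by apply: eq_bigr => n _; rewrite /mass /tr_sub odd_double doubleK.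
apply: le_trans (sM N); rewrite le_eqVlt; apply/orP; left; apply/eqP.
apply: eq_bigr => n _.
by rewrite /mass /tr_sub /= odd_double /= uphalf_double /ush_norm /= !normrN.
Qed.

(** [tr_sub] interleaves its arguments, so its partial sums of even length are differences of
    partial sums of [t] and [s]; the limit is computed along these. *)
Lemma tsum_sub B K t s : tr_summable t -> tr_summable s ->
  bounded_bilinear B K -> tsum B (tr_sub t s) = tsum B t - tsum B s.
Proof.
move=> ts ss [Bl _ BK].
have BN u v : B (- u) v = - B u v.
  have := Bl (-1) u 0 v; have := Bl (-1) 0 0 v.
  rewrite scaler0 !addr0 !scaleN1r addNr => -> -> .
  by rewrite addr0.
have tsc := tsum_cvg (tr_summable_sub ts ss) BK.
have dbl : (fun N => tpart B (tr_sub t s) N.*2) @ \oo --> tsum B (tr_sub t s).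
  move/cvgrPdist_le: tsc => tsc; apply/cvgrPdist_le => e /tsc[m _ mP].
  exists m => // N /= mN; apply: mP => /=.
  by rewrite (leq_trans mN)// -addnn leq_addl.
apply: (cvg_unique _ dbl); first exact: norm_hausdorff.
rewrite (_ : (fun _ => _) = tpart B t \- tpart B s).
  exact: cvgB (tsum_cvg ts BK) (tsum_cvg ss BK).
apply/funext => N; rewrite /tpart /= -sumrB.
rewrite (sum_double (fun n => B (tr_sub t s n).1 (tr_sub t s n).2)); apply: eq_bigr => n _.
by rewrite /tr_sub /= odd_double /= uphalf_double doubleK BN.
Qed.

(** The sum may be computed on an equivalent representation of total mass at most [e + d / (K + 1)],
    which costs at most [d] beyond [K * e]. *)
Lemma norm_tsum_proj B K e t : tr_summable t -> proj_norm_le t e ->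
  bounded_bilinear B K -> `|tsum B t| <= K * e.
Proof.
move=> ts te BB; have [_ _ BK] := BB; have K0 := dominated_ge0 BK.
have K1 : 0 < K + 1 by rewrite ltr_wpDl.
apply/ler_addgt0Pr => d d0; have [s [ets sM]] := te _ (divr_gt0 d0 K1).
rewrite (tsum_equiv ts _ ets BB); last by exists (e + d / (K + 1)).
apply: le_trans (norm_tsum_le BK sM) _.
rewrite mulrDr lerD2l mulrA ler_pdivrMr// mulrC ler_wpM2l ?ltW//.
by rewrite ltrDl.
Qed.

End TensorSumTheory.

(** * Bimodules over the unitization *)

Section LinearFunctions.
Context (K : pzRingType) (V W : lmodType K) (f : V -> W).
Hypothesis fl : linear f.
Let F : {linear V -> W} := HB.pack f (GRing.isLinear.Build _ _ _ _ f fl).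

Lemma linear_fun0 : f 0 = 0. Proof. exact: linear0 F. Qed.
Lemma linear_funD x y : f (x + y) = f x + f y. Proof. exact: linearD F x y. Qed.
Lemma linear_funB x y : f (x - y) = f x - f y. Proof. exact: linearB F x y. Qed.
Lemma linear_funZ k x : f (k *: x) = k *: f x.
Proof. by rewrite -[k *: x]addr0 fl linear_fun0 addr0. Qed.
End LinearFunctions.

(** Stated with the product of [R[i]] in place of its scaling, as [ring] expects. *)
Lemma functionalZ (R : realType) (X : normedModType R[i]) (f : {scalar X}) k x :
  f (k *: x) = k * f x.
Proof. exact: linearZ. Qed.

(* [ring] has no counterpart for modules, so functionals bring the identity to
   the scalars. *)
Ltac module_identity :=
  apply: eq_by_functionals; let f := fresh "f" in move=> f;
  rewrite ?(linearB f, linearD f, linearN f, linear0 f, functionalZ f); ring.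

Section Bimodule.
Context (R : realType).
Local Notation C := R[i].
Context (U : completeNormedModType C) (mul : U -> U -> U).
Context (X : completeNormedModType C) (lact : U -> X -> X) (ract : X -> U -> X).
Hypothesis mulP : banach_algebra mul.
Hypothesis actP : banach_bimodule mul lact ract.

Local Notation "p ** q" := (ush_mul mul p q) (at level 40, left associativity).
Local Notation "p ▹ x" := (ush_lact lact p x) (at level 38, right associativity).
Local Notation "x ◃ p" := (ush_ract ract x p) (at level 40, left associativity).
Implicit Types (p q c : ush U) (x y : X) (a b : U) (T : U -> X).

Lemma ush_lact_linearl x : linear (fun p => p ▹ x).
Proof.
have [lactl _] := actP => k p q.
rewrite /ush_lact lactl -[(_ + _).2]/(k * p.2 + q.2); module_identity.
Qed.

Lemma ush_lact_linear p : linear (fun x => p ▹ x).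
Proof.
have [_ [lactr _]] := actP => k x y.
by rewrite /ush_lact lactr; module_identity.
Qed.

Lemma ush_ract_linearr x : linear (fun p => x ◃ p).
Proof.
have [_ [_ [_ [ractr _]]]] := actP => k p q.
rewrite /ush_ract ractr -[(_ + _).2]/(k * p.2 + q.2); module_identity.
Qed.

Lemma ush_ract_linear p : linear (fun x => x ◃ p).
Proof.
have [_ [_ [ractl _]]] := actP => k x y.
by rewrite /ush_ract ractl; module_identity.
Qed.

Lemma ush_lactA p q x : (p ** q) ▹ x = p ▹ q ▹ x.
Proof.
have [lactl [lactr [_ [_ [lactA _]]]]] := actP.
have lin_l y : linear (lact ^~ y) by move=> k a b; exact: lactl.
have lin_r a : linear (lact a) by move=> k y z; exact: lactr.
rewrite /ush_lact /ush_mul /= (linear_funD (lin_l _)) (linear_funD (lin_l _)).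
rewrite !(linear_funZ (lin_l _)) lactA (linear_funD (lin_r _)).
by rewrite (linear_funZ (lin_r _)); module_identity.
Qed.

Lemma ush_ractA p q x : x ◃ (p ** q) = x ◃ p ◃ q.
Proof.
have [_ [_ [ractl [ractr [_ [ractA _]]]]]] := actP.
have lin_l a : linear (ract ^~ a) by move=> k y z; exact: ractl.
have lin_r y : linear (ract y) by move=> k a b; exact: ractr.
rewrite /ush_ract /ush_mul /= (linear_funD (lin_r _)) (linear_funD (lin_r _)).
rewrite !(linear_funZ (lin_r _)) ractA (linear_funD (lin_l _)).
by rewrite (linear_funZ (lin_l _)); module_identity.
Qed.

Lemma ush_lact_ract p q x : (p ▹ x) ◃ q = p ▹ (x ◃ q).
Proof.
have [_ [lactr [ractl [_ [_ [_ [lractA _]]]]]]] := actP.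
have lin_l a : linear (ract ^~ a) by move=> k y z; exact: ractl.
have lin_r a : linear (lact a) by move=> k y z; exact: lactr.
rewrite /ush_lact /ush_ract /= (linear_funD (lin_l _)) (linear_funZ (lin_l _)).
by rewrite (linear_funD (lin_r _)) (linear_funZ (lin_r _)) lractA; module_identity.
Qed.

Lemma norm_ush_lact p x : `|p ▹ x| <= ush_norm p * `|x|.
Proof.
have [_ [_ [_ [_ [_ [_ [_ [lactn _]]]]]]]] := actP.
by rewrite (le_trans (ler_normD _ _))// mulrDl lerD// normrZ.
Qed.

Lemma norm_ush_ract p x : `|x ◃ p| <= `|x| * ush_norm p.
Proof.
have [_ [_ [_ [_ [_ [_ [_ [_ ractn]]]]]]]] := actP.
by rewrite (le_trans (ler_normD _ _))// mulrDr lerD// normrZ mulrC.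
Qed.

Lemma norm_ush_mul p q : ush_norm (p ** q) <= ush_norm p * ush_norm q.
Proof.
have [_ _ _ muln] := mulP.
rewrite /ush_norm /= mulrDl !mulrDr -normrM addrA lerD2r.
apply: le_trans (ler_normD _ _) _; rewrite normrZ [_ * `|q.2|]mulrC.
rewrite addrAC lerD2r; apply: le_trans (ler_normD _ _) _.
by rewrite normrZ lerD2r muln.
Qed.

Definition ush_comm p x := p ▹ x - x ◃ p.

Section JordanDerivation.
Variable T : U -> X.
Hypothesis Tlin : linear T.
Hypothesis TJ : forall a b,
  T (mul a b + mul b a) = ract (T a) b + lact a (T b) + ract (T b) a + lact b (T a).

(** Extending [T] by [T(1) = 0] means applying it to first components. The scalar parts contribute
    [2 p.2 T(q.1) + 2 q.2 T(p.1)] to both sides, so the Jordan identity persists on the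
    unitization. *)
Lemma jordan_ush p q : T (p ** q + q ** p).1 =
  T p.1 ◃ q + p ▹ T q.1 + T q.1 ◃ p + q ▹ T p.1.
Proof.
rewrite /ush_mul /=.
have -> : mul p.1 q.1 + p.2 *: q.1 + q.2 *: p.1 + (mul q.1 p.1 + q.2 *: p.1 + p.2 *: q.1)
  = mul p.1 q.1 + mul q.1 p.1 + (2 * p.2) *: q.1 + (2 * q.2) *: p.1.
  by module_identity.
rewrite !(linear_funD Tlin _ (_ *: _)) !(linear_funZ Tlin) TJ.
by rewrite /ush_lact /ush_ract; module_identity.
Qed.

End JordanDerivation.

End Bimodule.

(** * The bilinear forms behind [psi], [pi] and [Phi] *)

Section BilinearForms.
Context (R : realType).
Local Notation C := R[i].
Context (U : completeNormedModType C) (mul : U -> U -> U).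
Context (X : completeNormedModType C) (lact : U -> X -> X) (ract : X -> U -> X).
Hypothesis mulP : banach_algebra mul.
Hypothesis actP : banach_bimodule mul lact ract.

Local Notation "p ** q" := (ush_mul mul p q) (at level 40, left associativity).
Local Notation "p ▹ x" := (ush_lact lact p x) (at level 38, right associativity).
Local Notation "x ◃ p" := (ush_ract ract x p) (at level 40, left associativity).
Local Notation ush_comm := (ush_comm lact ract).
Implicit Types (p q c : ush U) (x y : X) (a b : U) (T : U -> X) (t : tensor_rep U).

Lemma ush_mul_linearl q : linear (fun p => p ** q).
Proof.
have [_ mull _ _] := mulP => k p p'; rewrite /ush_mul /= mull.
congr pair; last by rewrite -[LHS]/((k * p.2 + p'.2) * q.2) mulrDl -mulrA.
rewrite -[(_ *: _).1]/(k *: (ush_mul mul p q).1) -[k *: p.2]/(k * p.2) /=.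
by module_identity.
Qed.

Lemma ush_mul_linear p : linear (fun q => p ** q).
Proof.
have [_ _ mulr _] := mulP => k q q'; rewrite /ush_mul /= mulr.
congr pair; last by rewrite -[LHS]/(p.2 * (k * q.2 + q'.2)) mulrDr mulrCA.
rewrite -[(_ *: _).1]/(k *: (ush_mul mul p q).1) -[k *: q.2]/(k * q.2) /=.
by module_identity.
Qed.

Lemma dominated_swap (B : ush U -> ush U -> X) K :
  dominated B K -> dominated (fun u v => B v u) K.
Proof. by move=> BK u v; rewrite mulrAC. Qed.

Lemma bounded_bilinear_swap (B : ush U -> ush U -> X) K :
  bounded_bilinear B K -> bounded_bilinear (fun u v => B v u) K.
Proof. by move=> [Bl Br BK]; split=> //; exact: dominated_swap. Qed.

Lemma bounded_bilinear_mull (B : ush U -> ush U -> X) K p :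
  bounded_bilinear B K -> bounded_bilinear (fun u v => B (p ** u) v) (K * ush_norm p).
Proof.
move=> [Bl Br BK]; have K0 := dominated_ge0 BK.
split=> // [k u u' v|u v]; first by rewrite (ush_mul_linear p k u u') Bl.
apply: le_trans (BK _ _) _; rewrite ler_wpM2r ?ush_norm_ge0// -mulrA.
by rewrite ler_wpM2l// (norm_ush_mul mulP).
Qed.

Lemma bounded_bilinear_mulr (B : ush U -> ush U -> X) K p :
  bounded_bilinear B K -> bounded_bilinear (fun u v => B (u ** p) v) (K * ush_norm p).
Proof.
move=> [Bl Br BK]; have K0 := dominated_ge0 BK.
split=> // [k u u' v|u v]; first by rewrite (ush_mul_linearl p k u u') Bl.
apply: le_trans (BK _ _) _; rewrite ler_wpM2r ?ush_norm_ge0// -mulrA.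
by rewrite ler_wpM2l// mulrC (norm_ush_mul mulP).
Qed.

Lemma tr_summable_lmul p t : tr_summable t -> tr_summable (tr_lmul mul p t).
Proof.
move=> [M tM]; exists (ush_norm p * M) => N.
apply: le_trans (ler_wpM2l (ush_norm_ge0 p) (tM N)); rewrite mulr_sumr.
apply: ler_sum => n _; rewrite mulrA ler_wpM2r ?ush_norm_ge0//.
exact: norm_ush_mul.
Qed.

Lemma tr_summable_rmul p t : tr_summable t -> tr_summable (tr_rmul mul t p).
Proof.
move=> [M tM]; exists (M * ush_norm p) => N.
apply: le_trans (ler_wpM2r (ush_norm_ge0 p) (tM N)); rewrite mulr_suml.
apply: ler_sum => n _; rewrite -mulrA ler_wpM2l ?ush_norm_ge0//.
exact: norm_ush_mul.
Qed.

Lemma tr_summable_flip t : tr_summable t -> tr_summable (tr_flip t).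
Proof.
move=> [M tM]; exists M => N; apply: le_trans (tM N).
by apply: ler_sum => n _ /=; rewrite mulrC.
Qed.

(** The entry point of symmetry: exchanging the arguments of the form amounts to summing it over the
    flipped tensor. *)
Lemma tsum_flip (B : ush U -> ush U -> X) K t :
  tr_summable t -> tr_equiv (tr_flip t) t -> bounded_bilinear B K ->
  tsum (fun u v => B v u) t = tsum B t.
Proof. by move=> ts tt; exact: tsum_equiv (tr_summable_flip ts) ts tt. Qed.

Lemma tsum_lmul_rmul (B : ush U -> ush U -> X) K t p :
  tr_summable t -> bounded_bilinear B K ->
  tsum B (tr_sub (tr_lmul mul p t) (tr_rmul mul t p)) =
  tsum (fun u v => B (p ** u) v) t - tsum (fun u v => B u (v ** p)) t.
Proof.
move=> ts; apply: tsum_sub; [exact: tr_summable_lmul|exact: tr_summable_rmul].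
Qed.

(** Summed over [t], this form gives [psi_y(t)], and [pi_form y] gives [pi(t) y]. *)
Definition psi_form y (u v : ush U) := u ▹ (y ◃ v).
Definition pi_form y (u v : ush U) := u ▹ v ▹ y.

Lemma bounded_bilinear_psi y : bounded_bilinear (psi_form y) `|y|.
Proof.
split=> [k u u' v|k u v v'|u v].
- exact: (ush_lact_linearl actP (y ◃ v) k u u').
- by rewrite /psi_form (ush_ract_linearr actP y k v v') (ush_lact_linear actP u k _ _).
apply: le_trans (norm_ush_lact actP _ _) _.
by rewrite [`|y| * _]mulrC -mulrA ler_wpM2l ?ush_norm_ge0// (norm_ush_ract actP).
Qed.

Lemma bounded_bilinear_pi y : bounded_bilinear (pi_form y) `|y|.
Proof.
split=> [k u u' v|k u v v'|u v].
- exact: (ush_lact_linearl actP (v ▹ y) k u u').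
- by rewrite /pi_form (ush_lact_linearl actP y k v v') (ush_lact_linear actP u k _ _).
apply: le_trans (norm_ush_lact actP _ _) _.
rewrite [`|y| * _]mulrC -mulrA ler_wpM2l ?ush_norm_ge0//.
by rewrite [leRHS]mulrC (norm_ush_lact actP).
Qed.

Definition phi_form T (u v : ush U) := u ▹ T v.1.

Lemma bounded_bilinear_phi T K : linear T -> 0 <= K ->
  (forall a, `|T a| <= K * `|a|) -> bounded_bilinear (phi_form T) K.
Proof.
move=> Tl K0 TK; split=> [k u u' v|k u v v'|u v].
- exact: (ush_lact_linearl actP (T v.1) k u u').
- rewrite /phi_form -[(_ + _).1]/(k *: v.1 + v'.1) Tl.
  exact: (ush_lact_linear actP u k _ _).
apply: le_trans (norm_ush_lact actP _ _) _.
rewrite [K * _]mulrC -mulrA ler_wpM2l ?ush_norm_ge0//.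
by apply: le_trans (TK _) _; rewrite ler_wpM2l// lerDl.
Qed.

End BilinearForms.

(** * Values of the forms on an approximate diagonal *)

Section Diagonals.
Context (R : realType).
Local Notation C := R[i].
Context (U : completeNormedModType C) (mul : U -> U -> U).
Context (X : completeNormedModType C) (lact : U -> X -> X) (ract : X -> U -> X).
Hypothesis mulP : banach_algebra mul.
Hypothesis actP : banach_bimodule mul lact ract.

Local Notation "p ** q" := (ush_mul mul p q) (at level 40, left associativity).
Local Notation "p ▹ x" := (ush_lact lact p x) (at level 38, right associativity).
Local Notation "x ◃ p" := (ush_ract ract x p) (at level 40, left associativity).
Local Notation ush_comm := (ush_comm lact ract).
Implicit Types (p q c : ush U) (x y : X) (a b : U) (T : U -> X) (t : tensor_rep U).

Local Notation pi_form := (pi_form lact).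
Local Notation psi_form := (psi_form lact ract).
Local Notation phi_form := (phi_form lact).

(** A functional [f] with [f y != 0] turns the vectors back into scalars, and the limit is
    [f z / f y]. *)
Lemma scale_cvg_scalar (u : nat -> C) y z : y != 0 ->
  (fun N => u N *: y) @ \oo --> z -> exists2 k : C, u @ \oo --> k & z = k *: y.
Proof.
move=> /separating_functional[f fy0 f2] uz; pose k : C := f z / f y.
have fy_gt0 : 0 < `|f y| by rewrite normr_gt0.
have uk : u @ \oo --> k.
  apply/cvgrPdist_le => e e0.
  have e1 : 0 < e * `|f y| / 2 by rewrite divr_gt0 ?mulr_gt0.
  move/cvgrPdist_le: uz => /(_ _ e1); apply: filterS => N zu.
  rewrite -(ler_pM2r fy_gt0) -normrM mulrBl /k divfK//.
  have -> : f z - u N * f y = f (z - u N *: y) by rewrite linearB [f (_ *: _)]linearZ /=.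
  apply: le_trans (f2 _) _; rewrite -ler_pdivlMl//.
  by rewrite mulrC.
exists k => //.
apply: (cvg_unique _ uz); first exact: norm_hausdorff.
exact: cvgZr_tmp uk.
Qed.

(** [tr_pi] is a pair of limits. The first converges by domination; subtracting its action on [y]
    from the partial sums of [pi_form y] leaves the scalar component times [y], whose convergence
    gives the second limit when [y] is nonzero. *)
Lemma tsum_pi y t : tr_summable t -> tsum (pi_form y) t = tr_pi mul t ▹ y.
Proof.
move=> ts; have [->|y0] := eqVneq y 0.
  rewrite (linear_fun0 (ush_lact_linear actP _)).
  apply: tsum_eq; rewrite (_ : tpart _ t = fun=> 0); first exact: cvg_cst.
  apply/funext => N; rewrite /tpart big1// => n _.
  by rewrite /pi_form !(linear_fun0 (ush_lact_linear actP _)).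
have [lactl [_ [_ [_ [_ [_ [_ [lactn _]]]]]]]] := actP.
have lact_lin : linear (lact ^~ y) by move=> k a b; exact: lactl.
pose mul1 (u v : ush U) := (u ** v).1.
have mul1_dom : dominated mul1 1.
  move=> u v; rewrite mul1r; apply: le_trans (norm_ush_mul mulP u v).
  by rewrite lerDl.
have cvg1 : (fun N => lact (tpart mul1 t N) y) @ \oo --> lact (tr_pi mul t).1 y.
  apply: (bounded_linear_cvg lact_lin (normr_ge0 y)) (tsum_cvg ts mul1_dom).
  by move=> a; rewrite mulrC lactn.
have [_ _ pi_dom] := bounded_bilinear_pi actP y.
pose u N : C := \sum_(n < N) ((t n).1 ** (t n).2).2.
have tpartE : (fun N => u N *: y) =
    (fun N => tpart (pi_form y) t N - lact (tpart mul1 t N) y).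
  apply/funext => N.
  rewrite -[LHS](addrK (lact (tpart mul1 t N) y)); congr (_ - _).
  rewrite addrC -[LHS]/((tpart mul1 t N, u N) ▹ y).
  have -> : (tpart mul1 t N, u N) = \sum_(n < N) (t n).1 ** (t n).2.
    elim: N => [|N IH]; first by rewrite /tpart /u !big_ord0.
    by rewrite big_ord_recr /= -IH /tpart /u !big_ord_recr.
  have F : linear (fun p => p ▹ y) := ush_lact_linearl actP y.
  rewrite /tpart; elim: N => [|N IH]; first by rewrite !big_ord0 (linear_fun0 F).
  by rewrite !big_ord_recr /= (linear_funD F) IH (ush_lactA actP).
have : (fun N => u N *: y) @ \oo --> tsum (pi_form y) t - lact (tr_pi mul t).1 y.
  by rewrite tpartE; exact: cvgB (tsum_cvg ts pi_dom) cvg1.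
move=> /(scale_cvg_scalar y0)[k uk E].
have -> : tsum (pi_form y) t = lact (tr_pi mul t).1 y + k *: y.
  by rewrite -E addrC subrK.
congr (_ + _ *: _); apply/esym.
by rewrite /tr_pi /=; apply: (@cvg_lim C); [exact: norm_hausdorff|exact: uk].
Qed.

Lemma tsum_lact B K t p : tr_summable t -> dominated B K ->
  tsum (fun u v => p ▹ B u v) t = p ▹ tsum B t.
Proof.
move=> ts BK; apply: tsum_linear (ush_lact_linear actP p) (ush_norm_ge0 p) _ ts BK.
exact: (norm_ush_lact actP).
Qed.

Lemma tsum_ract B K t p : tr_summable t -> dominated B K ->
  tsum (fun u v => B u v ◃ p) t = tsum B t ◃ p.
Proof.
move=> ts BK; apply: tsum_linear (ush_ract_linear actP p) (ush_norm_ge0 p) _ ts BK.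
by move=> x; rewrite mulrC (norm_ush_ract actP).
Qed.

(** [psi_y] is a bimodule map, so its commutator with [c] is its value on [c t - t c]. *)
Lemma psi_almost_central y t c e : tr_summable t ->
  proj_norm_le (tr_sub (tr_lmul mul c t) (tr_rmul mul t c)) e ->
  `|ush_comm c (tsum (psi_form y) t)| <= `|y| * e.
Proof.
move=> ts te; have psiB := bounded_bilinear_psi actP y; have [_ _ dom] := psiB.
have tss : tr_summable (tr_sub (tr_lmul mul c t) (tr_rmul mul t c)).
  by apply: tr_summable_sub; [exact: tr_summable_lmul|exact: tr_summable_rmul].
have psi_l : (fun u v => psi_form y (c ** u) v) = (fun u v => c ▹ psi_form y u v).
  by apply/funext => u; apply/funext => v; exact: (ush_lactA actP).
have psi_r : (fun u v => psi_form y u (v ** c)) = (fun u v => psi_form y u v ◃ c).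
  apply/funext => u; apply/funext => v.
  by rewrite (ush_lact_ract actP) -(ush_ractA actP).
have := norm_tsum_proj tss te psiB; rewrite (tsum_lmul_rmul mulP _ ts psiB).
by rewrite psi_l psi_r (tsum_lact _ ts dom) (tsum_ract _ ts dom).
Qed.

Lemma dominatedD (B B' : ush U -> ush U -> X) K K' : dominated B K -> dominated B' K' ->
  dominated (fun u v => B u v + B' u v) (K + K').
Proof.
move=> BK BK' u v; apply: le_trans (ler_normD _ _) _.
by rewrite !mulrDl lerD ?BK ?BK'.
Qed.

Lemma dominated_ract (B : ush U -> ush U -> X) K p : dominated B K ->
  dominated (fun u v => B u v ◃ p) (K * ush_norm p).
Proof.
move=> BK u v; apply: le_trans (norm_ush_ract actP _ _) _.
have -> : K * ush_norm p * ush_norm u * ush_norm v =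
  K * ush_norm u * ush_norm v * ush_norm p by ring.
by rewrite ler_wpM2r ?ush_norm_ge0.
Qed.

(* The forms [(u, v) |-> u T(v)] and [(u, v) |-> v T(u)] are both evaluated on
   [a t - t a]; by symmetry of [t] the difference of the two values contains
   [T] only through the Jordan product [v a + a v]. *)
Lemma jordan_almost_inner T (K : C) t p (e : C) : linear T -> 0 <= K ->
  (forall a, `|T a| <= K * `|a|) ->
  (forall a b, T (mul a b + mul b a) =
    ract (T a) b + lact a (T b) + ract (T b) a + lact b (T a)) ->
  tr_summable t -> tr_equiv (tr_flip t) t ->
  proj_norm_le (tr_sub (tr_lmul mul p t) (tr_rmul mul t p)) e ->
  `|ush_comm p (tsum (phi_form T) t) - tsum (pi_form (T p.1)) t
    - tsum (psi_form (T p.1)) t| <= 2 * (K * e).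
Proof.
move=> Tl K0 TK TJ ts tt te.
have phiB := bounded_bilinear_phi actP Tl K0 TK; have [_ _ phi_dom] := phiB.
have phiS := bounded_bilinear_swap phiB.
have tss : tr_summable (tr_sub (tr_lmul mul p t) (tr_rmul mul t p)).
  by apply: tr_summable_sub; [exact: tr_summable_lmul|exact: tr_summable_rmul].
have le1 := norm_tsum_proj tss te phiB; rewrite (tsum_lmul_rmul mulP _ ts phiB) in le1.
have le2 := norm_tsum_proj tss te phiS; rewrite (tsum_lmul_rmul mulP _ ts phiS) in le2.
have phiSl := bounded_bilinear_swap (bounded_bilinear_mull mulP p phiS).
have phiR := bounded_bilinear_mulr mulP p phiB.
have phiSr := bounded_bilinear_swap (bounded_bilinear_mulr mulP p phiS).
(* Symmetry of [t] turns the value of the swapped form on [p t - t p] into the sum of [u T(p v)]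
   minus that of [(u p) T(v)]. *)
have flip1 := tsum_flip ts tt phiSl.
have flip2 := tsum_flip ts tt phiR.
rewrite /= in flip1 flip2; rewrite flip1 flip2 in le2.
have phi_l : (fun u v => phi_form T (p ** u) v) = (fun u v => p ▹ phi_form T u v).
  by apply/funext => u; apply/funext => v; exact: (ush_lactA actP).
rewrite phi_l (tsum_lact _ ts phi_dom) in le1.
have [_ _ pi_dom] := bounded_bilinear_pi actP (T p.1).
have [_ _ psi_dom] := bounded_bilinear_psi actP (T p.1).
have [_ _ dSl] := phiSl; have [_ _ dSr] := phiSr; have [_ _ dR] := phiR.
(* Termwise this is [u T(v p + p v) = u T(v) p + u v T(p) + u T(p) v + u p T(v)]. *)
have jordan_sum : tsum (fun u v => phi_form T u (v ** p)) t +
    tsum (fun u v => phi_form T u (p ** v)) t =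
  tsum (phi_form T) t ◃ p + tsum (pi_form (T p.1)) t +
    tsum (psi_form (T p.1)) t + tsum (fun u v => phi_form T (u ** p) v) t.
  rewrite -(tsumD ts dSr dSl) -(tsum_ract _ ts phi_dom).
  rewrite -(tsumD ts (dominated_ract p phi_dom) pi_dom).
  have d1 := dominatedD (dominated_ract p phi_dom) pi_dom.
  rewrite -(tsumD ts d1 psi_dom) -(tsumD ts (dominatedD d1 psi_dom) dR).
  congr (tsum _ _); apply/funext => u; apply/funext => v; rewrite /phi_form.
  rewrite -(linear_funD (ush_lact_linear actP u)) -(linear_funD Tl).
  rewrite [T _](jordan_ush Tl TJ v p) 3!(linear_funD (ush_lact_linear actP u)).
  by rewrite (ush_lact_ract actP) (ush_lactA actP).
have -> : ush_comm p (tsum (phi_form T) t) - tsum (pi_form (T p.1)) t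
    - tsum (psi_form (T p.1)) t =
  (p ▹ tsum (phi_form T) t - tsum (fun u v => phi_form T u (v ** p)) t) -
  (tsum (fun u v => phi_form T u (p ** v)) t -
    tsum (fun u v => phi_form T (u ** p) v) t).
  rewrite /ush_comm.
  move/(canRL (addrK _)): jordan_sum => ->; module_identity.
by rewrite (le_trans (ler_normB _ _))// mulrDl mul1r lerD.
Qed.

End Diagonals.

(** * Nets of almost central Jordan derivations *)

Section AlmostDerivations.
Context (R : realType).
Local Notation C := R[i].
Context (U : completeNormedModType C) (mul : U -> U -> U).
Context (X : completeNormedModType C) (lact : U -> X -> X) (ract : X -> U -> X).
Hypothesis mulP : banach_algebra mul.
Hypothesis actP : banach_bimodule mul lact ract.

Local Notation "p ** q" := (ush_mul mul p q) (at level 40, left associativity).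
Local Notation "p ▹ x" := (ush_lact lact p x) (at level 38, right associativity).
Local Notation "x ◃ p" := (ush_ract ract x p) (at level 40, left associativity).
Local Notation ush_comm := (ush_comm lact ract).
Implicit Types (p q c : ush U) (x y : X) (a b : U) (T : U -> X) (t : tensor_rep U).

Local Notation pi_form := (pi_form lact).
Local Notation psi_form := (psi_form lact ract).
Local Notation phi_form := (phi_form lact).

(* Stated for abstract actions [l] and [r]: otherwise additivity of an action
   is matched up to unfolding and also splits [l p x] itself. *)
Lemma commutator_identity (A : Type) (l : A -> X -> X) (r : X -> A -> X) :
  (forall p : A, linear (l p)) -> (forall p : A, linear (r ^~ p)) ->
  (forall (p q : A) x, r (l p x) q = l p (r x q)) ->
  forall (c p q : A) x y,
  2 *: (l c (l p y) - l p (l c y) + l c (l q x) - l q (l c x)) =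
    (l c (r x q + l p y + r y p + l q x) - r (r x q + l p y + r y p + l q x) c)
    + (l c (l q x - r x q) - r (l q x - r x q) c)
    + (l c (l p y - r y p) - r (l p y - r y p) c)
    - 2 *: (l p (l c y - r y c) + l q (l c x - r x c)).
Proof.
move=> l_lin r_lin lr c p q x y.
have lD (a : A) := linear_funD (l_lin a); have lB (a : A) := linear_funB (l_lin a).
have rD (a : A) := linear_funD (r_lin a); have rB (a : A) := linear_funB (r_lin a).
by rewrite !(lB, rB) !(lD, rD) !lr; module_identity.
Qed.

Lemma norm_ush_comm p x : `|ush_comm p x| <= 2 * ush_norm p * `|x|.
Proof.
apply: le_trans (ler_normB _ _) _; rewrite -mulrA mulrDl mul1r lerD//.
  exact: (norm_ush_lact actP).
by rewrite [leRHS]mulrC (norm_ush_ract actP).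
Qed.

Context (L : Type) (F : set_system L) (FF : ProperFilter F).
Implicit Types (z w : L -> X).

Lemma null_bound (k : C) z : 0 <= k ->
  (forall e, 0 < e -> \forall l \near F, `|z l| <= k * e) -> z @ F --> (0 : X).
Proof.
move=> k0 zk; have k1 : 0 < k + 1 by rewrite ltr_wpDl.
apply/cvgr0Pnorm_le => e e0.
have := zk _ (divr_gt0 e0 k1); apply: filterS => l zl; apply: le_trans zl _.
by rewrite mulrA ler_pdivrMr// mulrC ler_wpM2l ?ltW// ltrDl.
Qed.

Lemma null_dominated (k : C) z w : 0 <= k -> (forall l, `|w l| <= k * `|z l|) ->
  z @ F --> (0 : X) -> w @ F --> (0 : X).
Proof.
move=> k0 wz /cvgr0Pnorm_le z0; apply: (null_bound k0) => e /z0.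
by apply: filterS => l zl; apply: le_trans (wz l) _; rewrite ler_wpM2l.
Qed.

Lemma null_lact p z : z @ F --> (0 : X) -> (fun l => p ▹ z l) @ F --> (0 : X).
Proof.
by apply: (null_dominated (ush_norm_ge0 p)) => l; exact: (norm_ush_lact actP).
Qed.

Lemma nullD z w : z @ F --> (0 : X) -> w @ F --> (0 : X) ->
  (fun l => z l + w l) @ F --> (0 : X).
Proof. by move=> z0 w0; rewrite -[0 : X]addr0; exact: cvgD z0 w0. Qed.

Lemma nullB z w : z @ F --> (0 : X) -> w @ F --> (0 : X) ->
  (fun l => z l - w l) @ F --> (0 : X).
Proof. by move=> z0 w0; rewrite -[0 : X]subr0; exact: cvgB z0 w0. Qed.

Lemma nullZ (k : C) z : z @ F --> (0 : X) -> (fun l => k *: z l) @ F --> (0 : X).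
Proof. by apply: (null_dominated (normr_ge0 k)) => l; rewrite normrZ. Qed.

(** Dominated convergence: the common bound [K] makes the tails small uniformly in [l], and what
    remains is a finite sum of null nets. *)
Lemma tsum_null (B : L -> ush U -> ush U -> X) (K : C) t : tr_summable t ->
  (forall l, dominated (B l) K) ->
  (forall u v, (fun l => B l u v) @ F --> (0 : X)) ->
  (fun l => tsum (B l) t) @ F --> (0 : X).
Proof.
move=> ts BK B0; have [l0 _] := filter_ex (@filterT _ F _).
have K0 := dominated_ge0 (BK l0).
apply: (@null_bound (K + 1)) => [|e e0]; first by rewrite addr_ge0.
have [N tN] := tsum_tail X ts e0.
have part0 : (fun l => tpart (B l) t N) @ F --> (0 : X).
  elim: N {tN} => [|N IH].
    rewrite (_ : (fun _ => _) = fun=> 0); first exact: cvg_cst.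
    by apply/funext => l; rewrite /tpart big_ord0.
  rewrite (_ : (fun _ => _) = fun l => tpart (B l) t N + B l (t N).1 (t N).2).
    exact: nullD.
  by apply/funext => l; rewrite /tpart big_ord_recr.
move/cvgr0Pnorm_le: part0 => /(_ _ e0); apply: filterS => l le_part.
rewrite -(subrK (tpart (B l) t N) (tsum _ _)).
apply: le_trans (ler_normD _ _) _; rewrite mulrDl mul1r lerD//.
exact: tN.
Qed.

Lemma norm_le_double x : `|x| <= `|2 *: x|.
Proof. by rewrite normrZ -[leLHS]mul1r ler_wpM2r// ger0_norm// ler1n. Qed.

Lemma dominated_lact (B : ush U -> ush U -> X) (K : C) p : dominated B K ->
  dominated (fun u v => p ▹ B u v) (K * ush_norm p).
Proof.
move=> BK u v; apply: le_trans (norm_ush_lact actP _ _) _.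
have -> : K * ush_norm p * ush_norm u * ush_norm v =
  ush_norm p * (K * ush_norm u * ush_norm v) by ring.
by rewrite ler_wpM2l ?ush_norm_ge0.
Qed.

Section Family.
Variables (E : L -> U -> X) (K : C).
Hypothesis E_linear : forall l, linear (E l).
Hypothesis K_ge0 : 0 <= K.
Hypothesis E_bound : forall l a, `|E l a| <= K * `|a|.
Hypothesis E_jordan : forall l a b, E l (mul a b + mul b a) =
  ract (E l a) b + lact a (E l b) + ract (E l b) a + lact b (E l a).
Hypothesis E_central : forall c p, (fun l => ush_comm c (E l p.1)) @ F --> (0 : X).

(* Applying [ush_comm c] to the Jordan identity for [p] and [q] leaves, up to
   null terms, [2 ([c, p] E(q) + [c, q] E(p))]. *)
Lemma commutator_swap c p q : (fun l => c ▹ p ▹ E l q.1 - p ▹ c ▹ E l q.1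
  + c ▹ q ▹ E l p.1 - q ▹ c ▹ E l p.1) @ F --> (0 : X).
Proof.
have swap l : 2 *: (c ▹ p ▹ E l q.1 - p ▹ c ▹ E l q.1
    + c ▹ q ▹ E l p.1 - q ▹ c ▹ E l p.1) =
  ush_comm c (E l (p ** q + q ** p).1) + ush_comm c (ush_comm q (E l p.1))
    + ush_comm c (ush_comm p (E l q.1))
    - 2 *: (p ▹ ush_comm c (E l q.1) + q ▹ ush_comm c (E l p.1)).
  rewrite (jordan_ush (E_linear l) (E_jordan l)).
  exact: commutator_identity (ush_lact_linear actP) (ush_ract_linear actP)
    (ush_lact_ract actP) _ _ _ _ _.
have comm0 (p' q' s : ush U) : (fun l => ush_comm p' (ush_comm q' (E l s.1))) @ F --> (0 : X).
  apply: null_dominated (E_central q' s); last by move=> l; exact: norm_ush_comm.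
  by rewrite mulr_ge0 ?ush_norm_ge0.
suff null2 : (fun l => 2 *: (c ▹ p ▹ E l q.1 - p ▹ c ▹ E l q.1
    + c ▹ q ▹ E l p.1 - q ▹ c ▹ E l p.1)) @ F --> (0 : X).
  by apply: null_dominated ler01 _ null2 => l; rewrite mul1r; exact: norm_le_double.
rewrite (funext swap); apply: nullB;
  last by apply: nullZ; apply: nullD; apply: null_lact; exact: E_central.
by apply: nullD; [apply: nullD; [exact: E_central|exact: comm0]|exact: comm0].
Qed.

(* The form tends to 0 by [commutator_swap] and approximate centrality; in
   the sum over [t] its last term may be replaced by [pi_form (E l p.1) u v]. *)
Definition comparison_form p l (u v : ush U) :=
  ush_comm p (phi_form (E l) u v) - psi_form (E l p.1) u v + pi_form (E l p.1) v u.

Lemma comparison_form_null p u v :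
  (fun l => comparison_form p l u v) @ F --> (0 : X).
Proof.
have E1 l : comparison_form p l u v =
    u ▹ ush_comm p (E l v.1) + u ▹ ush_comm v (E l p.1) -
    (u ▹ p ▹ E l v.1 - p ▹ u ▹ E l v.1 + u ▹ v ▹ E l p.1 - v ▹ u ▹ E l p.1).
  rewrite /comparison_form /phi_form /psi_form /pi_form /ush_comm.
  rewrite !(linear_funB (ush_lact_linear actP u)) (ush_lact_ract actP).
  by module_identity.
rewrite (funext E1); apply: nullB; last exact: commutator_swap.
by apply: nullD; apply: null_lact; exact: E_central.
Qed.

Lemma comparison_form_dominated p l :
  dominated (comparison_form p l) (4 * K * ush_norm p).
Proof.
move=> u v; have [_ _ phi_dom] := bounded_bilinear_phi actP (E_linear l) K_ge0 (E_bound l).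
have [_ _ psi_dom] := bounded_bilinear_psi actP (E l p.1).
have [_ _ pi_dom] := bounded_bilinear_pi actP (E l p.1).
have Ep : `|E l p.1| <= K * ush_norm p.
  by apply: le_trans (E_bound l _) _; rewrite ler_wpM2l// lerDl.
pose w := ush_norm u * ush_norm v.
have w0 : 0 <= w by rewrite mulr_ge0 ?ush_norm_ge0.
(* The commutator with [p] costs [2 * ush_norm p * K], the other two forms [K * ush_norm p] each. *)
have -> : 4 * K * ush_norm p * ush_norm u * ush_norm v =
    2 * ush_norm p * (K * w) + K * ush_norm p * w + K * ush_norm p * w.
  by rewrite /w; ring.
apply: le_trans (ler_normD _ _) _; apply: lerD.
  apply: le_trans (ler_normB _ _) _; apply: lerD.
    apply: le_trans (norm_ush_comm _ _) _.
    by rewrite ler_wpM2l ?mulr_ge0 ?ush_norm_ge0// /w mulrA phi_dom.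
  by apply: le_trans (psi_dom _ _) _; rewrite -mulrA ler_wpM2r.
by apply: le_trans (pi_dom _ _) _; rewrite mulrAC -mulrA ler_wpM2r.
Qed.

Lemma tsum_comparison_form p l t : tr_summable t -> tr_equiv (tr_flip t) t ->
  tsum (comparison_form p l) t = ush_comm p (tsum (phi_form (E l)) t)
    - tsum (psi_form (E l p.1)) t + tsum (pi_form (E l p.1)) t.
Proof.
move=> ts tt.
have [_ _ phi_dom] := bounded_bilinear_phi actP (E_linear l) K_ge0 (E_bound l).
have [_ _ psi_dom] := bounded_bilinear_psi actP (E l p.1).
have piB := bounded_bilinear_pi actP (E l p.1).
have [_ _ piS_dom] := bounded_bilinear_swap piB.
have comm_dom : dominated (fun u v => ush_comm p (phi_form (E l) u v)) (2 * ush_norm p * K).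
  move=> u v; apply: le_trans (norm_ush_comm _ _) _.
  by rewrite -!mulrA 2?ler_wpM2l ?ush_norm_ge0// mulrA phi_dom.
have diff_dom : dominated (fun u v => ush_comm p (phi_form (E l) u v) -
    psi_form (E l p.1) u v) (2 * ush_norm p * K + `|E l p.1|).
  move=> u v; apply: le_trans (ler_normB _ _) _.
  have -> : forall a b c d : C, (a + b) * c * d = a * c * d + b * c * d.
    by move=> a b c d; ring.
  by rewrite lerD; [|exact: comm_dom|exact: psi_dom].
rewrite /comparison_form (tsumD ts diff_dom piS_dom) (tsum_flip ts tt piB).
rewrite (tsumB ts comm_dom psi_dom); congr (_ - _ + _).
have l_dom := dominated_lact p phi_dom; have r_dom := dominated_ract actP p phi_dom.
rewrite /ush_comm (tsumB ts l_dom r_dom).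
by rewrite (tsum_lact actP _ ts phi_dom) (tsum_ract actP _ ts phi_dom).
Qed.

(** Write [a], [b], [c] for the [pi], [psi] and commutator terms. The comparison sum is [c - b + a],
    while [jordan_almost_inner] bounds [c - a - b]; the two differ by [2 a]. *)
Lemma tsum_pi_bound p l t e : tr_summable t -> tr_equiv (tr_flip t) t ->
  proj_norm_le (tr_sub (tr_lmul mul p t) (tr_rmul mul t p)) e ->
  `|tr_pi mul t ▹ E l p.1| <= `|tsum (comparison_form p l) t| + 2 * (K * e).
Proof.
move=> ts tt te; rewrite -(tsum_pi mulP actP _ ts).
apply: le_trans (norm_le_double _) _.
have := jordan_almost_inner mulP actP (E_linear l) K_ge0 (E_bound l) (E_jordan l) ts tt te.
move: (tsum_comparison_form p l ts tt).
set a := tsum (pi_form _) t; set b := tsum (psi_form _) t.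
set c := ush_comm p _; set S := tsum (comparison_form _ _) t => SE le.
have -> : 2 *: a = S - (c - a - b) by rewrite SE; module_identity.
by apply: le_trans (ler_normB _ _) _; rewrite lerD2l.
Qed.

End Family.

End AlmostDerivations.

(** * Nets as filters of tails *)

Section Nets.
Context (L : Type) (le : L -> L -> Prop).

Definition net_filter : set_system L := eventually_net le.

Lemma net_filter_proper : directed le -> ProperFilter net_filter.
Proof.
move=> [le_refl le_trans le_ub [l0]]; apply: Build_ProperFilter_ex.
  by move=> P [l lP]; exists l; exact: lP.
split=> [|P Q [l lP] [l' lQ]|P Q PQ [l lP]]; first by exists l0.
  have [m [lm l'm]] := le_ub l l'.
  by exists m => k mk; split;
    [exact: lP (le_trans _ _ _ lm mk)|exact: lQ (le_trans _ _ _ l'm mk)].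
by exists l => k /lP /PQ.
Qed.

End Nets.

(** * Perturbation by inner derivations and the conclusion *)

Section JordanDerivations.
Context (R : realType).
Local Notation C := R[i].
Context (U : completeNormedModType C) (mul : U -> U -> U).
Context (X : completeNormedModType C) (lact : U -> X -> X) (ract : X -> U -> X).
Hypothesis mulP : banach_algebra mul.
Hypothesis actP : banach_bimodule mul lact ract.

Local Notation "p ▹ x" := (ush_lact lact p x) (at level 38, right associativity).
Local Notation ush_comm := (ush_comm lact ract).

(** The adjoined unit [(0, 1)] acts trivially on [X]. With [p = pi(t)] close to the unit in norm,
    the estimate is uniform over bounded sets of [y]. *)
Lemma ush_lact_near_unit (p : ush U) (y : X) :
  `|p ▹ y - y| <= ush_norm (ush_mul mul p (0, 1) - (0, 1)) * `|y|.
Proof.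
apply: le_trans (norm_ush_lact actP _ _).
rewrite (linear_funB (ush_lact_linearl actP y)) (ush_lactA actP).
have -> // : (0, 1) ▹ y = y.
have [lactl _] := actP; have lact_lin : linear (lact ^~ y) by move=> k a b; exact: lactl.
by rewrite /ush_lact /= (linear_fun0 lact_lin) scale1r add0r.
Qed.

Lemma ush_commE (p : ush U) (x : X) : ush_comm p x = lact p.1 x - ract x p.1.
Proof. by rewrite /ush_comm /ush_lact /ush_ract; module_identity. Qed.

Lemma inner_difference_jordan (D : U -> X) (x : X) : jordan_derivation mul lact ract D ->
  jordan_derivation mul lact ract (fun a => lact a x - ract x a - D a).
Proof.
move=> [Dl DJ]; have [lactl [lactr [ractl [ractr [lactA [ractA [lractA _]]]]]]] := actP.
have ll y : linear (lact ^~ y) by move=> k a b; exact: lactl.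
have lr a : linear (lact a) by move=> k y z; exact: lactr.
have rl a : linear (ract ^~ a) by move=> k y z; exact: ractl.
have rr y : linear (ract y) by move=> k a b; exact: ractr.
split=> [k a b|a b]; first by rewrite Dl (ll x k a b) (rr x k a b); module_identity.
rewrite DJ (linear_funD (ll x)) (linear_funD (rr x)) !lactA !ractA.
rewrite !(linear_funB (lr _)) !(linear_funB (rl _)) !lractA.
by module_identity.
Qed.

(** The inner part obeys the Leibniz rule and cancels, so the defect of [D] is minus that of [E]. *)
Lemma inner_difference_derivation (D : U -> X) (x : X) a b :
  let E a := lact a x - ract x a - D a in
  D (mul a b) - (ract (D a) b + lact a (D b)) =
  ract (E a) b + lact a (E b) - E (mul a b).
Proof.
have [_ [lactr [ractl [_ [lactA [ractA [lractA _]]]]]]] := actP.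
have lr c : linear (lact c) by move=> k y z; exact: lactr.
have rl c : linear (ract ^~ c) by move=> k y z; exact: ractl.
rewrite /= !lactA !ractA !(linear_funB (lr _)) !(linear_funB (rl _)) !lractA.
by module_identity.
Qed.

End JordanDerivations.

Theorem theorem5p1 (R : realType)
    (U : completeNormedModType R[i]) (mul : U -> U -> U)
    (X : completeNormedModType R[i]) (lact : U -> X -> X) (ract : X -> U -> X)
    (L : Type) (le : L -> L -> Prop) (t : L -> tensor_rep U) :
  banach_algebra mul ->
  banach_bimodule mul lact ract ->
  directed le ->
  symmetric_approx_diagonal mul le t ->
  (forall x : X, exists M : R[i], forall l, `|tr_psi lact ract x (t l)| <= M) ->
  (forall D : U -> X, bounded_map D -> jordan_derivation mul lact ract D ->
     exists M : R[i], forall l, `|tr_Phi lact D (t l)| <= M) ->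
  forall D : U -> X, bounded_map D -> jordan_derivation mul lact ract D ->
    derivation mul lact ract D.
Proof.
move=> mulP actP dir [ts tt te tpi] _ phi_bounded D Dbounded DJ.
have [M xM] := phi_bounded D Dbounded DJ.
have [K0 DK0] := Dbounded; have [D_linear D_jordan] := DJ.
(* The constant in [bounded_map] need not be nonnegative; its modulus is, and bounds [D] as well. *)
pose K : R[i] := `|K0|; have K_ge0 : 0 <= K := normr_ge0 _.
have DK a : `|D a| <= K * `|a|.
  by rewrite /K -(normr_id a) -normrM ger0_norm ?(le_trans _ (DK0 a)).
have FF := net_filter_proper dir; set F := net_filter le in FF.
have diag_near p (e : R[i]) : 0 < e -> 
    F [set l | proj_norm_le (tr_sub (tr_lmul mul p (t l)) (tr_rmul mul (t l) p)) e].
  exact: te.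
have pi_near (e : R[i]) : 0 < e -> 
    F [set l | forall y : X, `|ush_lact lact (tr_pi mul (t l)) y - y| <= e * `|y|].
  move=> e0; have unit_near : F _ := tpi (0, 1) e e0.
  apply: filterS unit_near => l le_e y.
  by apply: le_trans (ush_lact_near_unit actP _ _) _; rewrite ler_wpM2r.
clearbody F.
pose x l := tr_Phi lact D (t l).
have {}xM l : `|x l| <= M := xM l.
pose E l a := lact a (x l) - ract (x l) a - D a.
have E_jd l : jordan_derivation mul lact ract (E l) := inner_difference_jordan actP (x l) DJ.
have E_linear l : linear (E l) by move=> k a b; case: (E_jd l) => + _; apply.
have E_jordan l := (E_jd l).2.
have M_ge0 : 0 <= M.
  by have [l _] := filter_ex (@filterT _ F _); exact: le_trans (normr_ge0 _) (xM l).
(* [2 * M] bounds the commutator with [x l], and [K] bounds [D]; the result is uniform in [l]. *)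
pose K' : R[i] := 2 * M + K; have K'_ge0 : 0 <= K' by rewrite addr_ge0// mulr_ge0.
have [_ [_ [_ [_ [_ [_ [_ [lactn ractn]]]]]]]] := actP.
have E_bound l a : `|E l a| <= K' * `|a|.
  apply: le_trans (ler_normB _ _) _; rewrite mulrDl lerD//.
  apply: le_trans (ler_normB _ _) _; rewrite -mulrA mulrDl mul1r lerD//.
    by apply: le_trans (lactn _ _) _; rewrite [leLHS]mulrC ler_wpM2r ?xM.
  by apply: le_trans (ractn _ _) _; rewrite ler_wpM2r ?xM.
(* [E l p.1] splits into the error [r] of (1), the term [pi(t) y - y], and [psi_y(t)]. The first two
   become small; the third need not, but its commutator with [c] does. *)
have E_central (c p : ush U) : (fun l => ush_comm lact ract c (E l p.1)) @ F --> (0 : X).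
  set y := D p.1.
  pose k : R[i] := 2 * ush_norm c * (2 * K + `|y|) + `|y|.
  have c0 : 0 <= 2 * ush_norm c by rewrite mulr_ge0 ?ush_norm_ge0.
  apply: (@null_bound _ _ _ _ _ k); first by rewrite !(addr_ge0, mulr_ge0).
  move=> e e0; have near3 := @filterI _ _ FF _ _
    (@filterI _ _ FF _ _ (diag_near p e e0) (diag_near c e e0)) (pi_near e e0).
  apply: (@filterS _ (nbhs F) FF _ _ _ near3) => l [[p_e c_e] pi_e].
  have := jordan_almost_inner mulP actP D_linear K_ge0 DK D_jordan (ts l) (tt l) p_e.
  rewrite (tsum_pi mulP actP _ (ts l)) -/y.
  set r := (X in `|X| <= _) => r_e.
  have -> : E l p.1 = r + (ush_lact lact (tr_pi mul (t l)) y - y) +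
      tsum (psi_form lact ract y) (t l).
    rewrite /r ush_commE /E -/y -/(tr_Phi lact D (t l)) -/(x l).
    by module_identity.
  set s := _ - y; set psi := tsum _ _.
  have -> : ush_comm lact ract c (r + s + psi) =
    ush_comm lact ract c (r + s) + ush_comm lact ract c psi.
    rewrite /ush_comm.
    rewrite (linear_funD (ush_lact_linear actP c) _ psi).
    rewrite (linear_funD (ush_ract_linear actP c) _ psi).
    by module_identity.
  apply: le_trans (ler_normD _ _) _; rewrite /k mulrDl lerD//.
    apply: le_trans (norm_ush_comm actP _ _) _; rewrite -[leRHS]mulrA ler_wpM2l//.
    apply: le_trans (ler_normD _ _) _; rewrite mulrDl lerD//.
      by rewrite -mulrA.
    by rewrite mulrC; exact: pi_e.
  exact: (psi_almost_central mulP actP y (ts l) c_e).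
have E_null a : (fun l => E l a) @ F --> (0 : X).
  pose p : ush U := (a, 0).
  apply: (@null_bound _ _ _ _ _ (K' * `|a| + (2 * K' + 1))).
    by rewrite !(addr_ge0, mulr_ge0).
  (* The index [m] is fixed before [l] moves, so that the comparison forms are summed over a single
     tensor [t m]. The error [pi(t_m) E_l(a) - E_l(a)] then costs [K' * |a| * e], and
     [tsum_pi_bound] the rest. *)
  move=> e e0; have [m [p_e pi_e]] := filter_ex (filterI (diag_near p e e0) (pi_near e e0)).
  have := tsum_null FF (ts m)
    (comparison_form_dominated actP E_linear K'_ge0 E_bound p)
    (comparison_form_null actP FF E_linear E_jordan E_central p).
  move/cvgr0Pnorm_le => /(_ e e0); apply: filterS => l S_e.
  rewrite -[E l a](subKr (ush_lact lact (tr_pi mul (t m)) (E l a))).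
  apply: le_trans (ler_normB _ _) _; rewrite addrC mulrDl lerD//.
    apply: le_trans (pi_e _) _.
    by rewrite [leLHS]mulrC ler_wpM2r ?(ltW e0) ?E_bound.
  have := tsum_pi_bound mulP actP E_linear K'_ge0 E_bound E_jordan l (ts m) (tt m) p_e.
  move/le_trans; apply.
  have -> : (2 * K' + 1) * e = e + 2 * (K' * e) by ring.
  by rewrite lerD2r.
split=> // a b; apply: subr0_eq.
have E_defect : (fun l => ract (E l a) b + lact a (E l b) - E l (mul a b)) @ F --> (0 : X).
  apply: (nullB FF); last exact: E_null.
  apply: (nullD FF).
    apply: (null_dominated FF (normr_ge0 b) _ (E_null a)) => l.
    by rewrite mulrC ractn.
  by apply: (null_dominated FF (normr_ge0 a) _ (E_null b)) => l; exact: lactn.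
apply/eqP; rewrite -normr_le0.
apply/ler_addgt0Pr => e e0; rewrite add0r.
(* The defect of [D] does not depend on [l], so one index for each [e] suffices. *)
move/cvgr0Pnorm_le: E_defect => /(_ e e0) defect_e; have [l] := filter_ex defect_e.
by rewrite -(inner_difference_derivation actP D (x l) a b).
Qed.
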